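(* Let $n\geq 1$ and assume that the events $E_1,\ldots,E_{n+1},H_1,\ldots,H_{n+1}$ are logically independent. Let $\mathcal{C}_n=\bigwedge_{i=1}^n(E_i|H_i)$ and $\mathcal{C}_{n+1}=\bigwedge_{i=1}^{n+1}(E_i|H_i)$. Let $\mathcal{I}$ be the convex hull of the points $Q_1=(1,1,1)$, $Q_2=(1,0,0)$, $Q_3=(0,1,0)$, $Q_4=(0,0,0)$. Then the assessment $\mathcal{M}=(\mu_n,x_{n+1},\mu_{n+1})$ on the family $\{\mathcal{C}_n,E_{n+1}|H_{n+1},\mathcal{C}_{n+1}\}$ (i.e. $\mathbb{P}(\mathcal{C}_n)=\mu_n$, $P(E_{n+1}|H_{n+1})=x_{n+1}$, $\mathbb{P}(\mathcal{C}_{n+1})=\mu_{n+1}$) is coherent if and only if $\mathcal{M}\in\mathcal{I}$, that is if and only if $$(\mu_n,x_{n+1})\in[0,1]^2,\qquad \mu_{n+1}'\leq\mu_{n+1}\leq\mu_{n+1}'',$$ where $\mu_{n+1}'=\max\{\mu_n+x_{n+1}-1,0\}$ and $\mu_{n+1}''=\min\{\mu_n,x_{n+1}\}$.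
   Context: Events are two-valued propositions (identified with subsets of the sure event $\Omega$, and with their indicators); $\overline{A}$ is negation, $AB$ is conjunction. Events $A_1,\ldots,A_r$ are logically independent if all $2^r$ conjunctions $\bigwedge_i A_i^{*}$, with $A_i^*\in\{A_i,\overline{A}_i\}$, are possible (nonempty). For events $E,H$ with $H\neq\emptyset$, the conditional event $E|H$ is true if $EH$ is true, false if $\overline{E}H$ is true, void if $\overline{H}$ is true. A conditional random quantity $X|H$ ($X$ with finitely many values, $H\ne\emptyset$) with assessed prevision $\mu=\mathbb{P}(X|H)$ is identified with the random quantity $XH+\mu\overline{H}$; in particular $E|H=EH+x\overline{H}$ with $x=P(E|H)$. Coherence: an assessment of previsions $\mu_j=\mathbb{P}(X_j|K_j)$ on a family of conditional random quantities is coherent if, for every finite subfamily $\{X_1|K_1,\ldots,X_r|K_r\}$ and all real $s_1,\ldots,s_r$, the gain $G=\sum_j s_jK_j(X_j-\mu_j)$ restricted to $K_1\vee\cdots\vee K_r$ satisfies $\min G\leq 0\leq\max G$. Conjunction. Given conditional events $E_1|H_1,\ldots,E_N|H_N$, for each nonempty $S\subseteq\{1,\ldots,N\}$ let $x_S$ be the assessed prevision of $\mathcal{C}_S=\bigwedge_{i\in S}(E_i|H_i)$ ($x_{\{i\}}=x_i=P(E_i|H_i)$). $\mathcal{C}_S$ is the random quantity, conditional on $\bigvee_{i\in S}H_i$, with value $1$ if all $E_i|H_i$, $i\in S$, are true; $0$ if at least one is false; $x_V$ if none is false and the set $V\subseteq S$ of indices of void ones is nonempty (so its value is its prevision $x_S$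 when all $H_i$, $i\in S$, are false). Convention: the numbers $x_S$ are always specified so as to form a coherent assessment on the family of all $\mathcal{C}_S$; accordingly, an assessment on a subfamily of the $\mathcal{C}_S$ is coherent if it is the restriction of a coherent assessment $(x_S)_{\emptyset\neq S\subseteq\{1,\ldots,N\}}$ on the family of all $\mathcal{C}_S$. *)

(* Defs.v *)
From HB Require Import structures.
From mathcomp Require Import all_boot all_order all_algebra.
From mathcomp Require Import boolp classical_sets reals numfun.

Set Implicit Arguments.
Unset Strict Implicit.
Unset Printing Implicit Defensive.

Import Order.TTheory GRing.Theory Num.Theory.
Local Open Scope ring_scope.

Definition logically_independent (Omega : Type) (I : finType)
    (A : I -> set Omega) : Prop :=
  forall b : I -> bool,
    (\bigcap_(i in setT) (if b i then A i else ~` A i) !=set0)%classic.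

Definition all_events (Omega : Type) (N : nat) (E H : 'I_N -> set Omega)
    (k : 'I_N + 'I_N) : set Omega :=
  match k with inl i => E i | inr i => H i end.

Definition is_min (R : realType) (A : set R) (m : R) : Prop :=
  A m /\ lbound A m.
Definition is_max (R : realType) (A : set R) (m : R) : Prop :=
  A m /\ ubound A m.

Definition gain (R : realType) (Omega : Type) (I : finType)
    (X : I -> Omega -> R) (K : I -> set Omega) (mu s : I -> R)
    (J : {set I}) (w : Omega) : R :=
  \sum_(j in J) s j * \1_(K j) w * (X j w - mu j).

(* Coherence of the previsions [mu j], [j] in [F], of the conditional random
   quantities [X j | K j]. Only the values of [X j] on [K j] matter. The empty
   subfamily is excluded, since the gain would be restricted to the
   impossible event. *)
Definition coherent (R : realType) (Omega : Type) (I : finType) (F : {set I})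
    (X : I -> Omega -> R) (K : I -> set Omega) (mu : I -> R) : Prop :=
  forall (J : {set I}) (s : I -> R), J \subset F -> J != finset.set0 ->
  let G := (gain X K mu s J @` \bigcup_(j in [set` J]) K j)%classic in
  exists m M : R, [/\ is_min G m, is_max G M, m <= 0 & 0 <= M].

Section Conjunction.
Variables (R : realType) (Omega : Type) (N : nat) (E H : 'I_N -> set Omega).

Definition ce_false (i : 'I_N) (w : Omega) : bool :=
  (w \in H i) && (w \notin E i).
Definition ce_void (i : 'I_N) (w : Omega) : bool := w \notin H i.

(* [conjunction x S] is the random quantity C_S, for [S] nonempty, where [x V]
   is the prevision of C_V. The value [x set0] is never used. *)
Definition conjunction (x : {set 'I_N} -> R) (S : {set 'I_N}) (w : Omega) : R :=
  if [exists i in S, ce_false i w] then 0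
  else let V := [set i in S | ce_void i w]%SET in
       if V == finset.set0 then 1 else x V.

Definition conditioning (S : {set 'I_N}) : set Omega :=
  (\bigcup_(i in [set` S]) H i)%classic.

(* On a singleton the conjunction is the conditional event
   E_i | H_i = E_i H_i + x_i ~H_i itself. *)
Lemma conjunction1 (x : {set 'I_N} -> R) (i : 'I_N) (w : Omega) :
  conjunction x [set i]%SET w =
  \1_(E i `&` H i)%classic w + x [set i]%SET * \1_(~` H i)%classic w.
Proof.
rewrite /conjunction !indicE in_setI in_setC.
have -> : [exists j in [set i]%SET, ce_false j w] = ce_false i w.
  apply/existsP/idP => [[j /andP[]]|fi]; first by rewrite finset.in_set1 => /eqP ->.
  by exists i; rewrite finset.in_set1 eqxx.
have -> : [set j in [set i]%SET | ce_void j w]%SET =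
          if ce_void i w then [set i]%SET else finset.set0.
  apply/setP => j; rewrite !finset.inE.
  by case: eqP => [->|/eqP/negPf ji]; case: ifP; rewrite !finset.inE ?eqxx ?ji.
rewrite /ce_false /ce_void.
case: (w \in H i); case: (w \in E i);
  rewrite /= ?eqxx ?mulr0 ?mulr1 ?addr0 ?add0r //.
all: by case: eqP => // /setP/(_ i); rewrite !finset.inE eqxx.
Qed.

Definition coherent_conjunctions (x : {set 'I_N} -> R) : Prop :=
  coherent [set S : {set 'I_N} | S != finset.set0]%SET
    (conjunction x) conditioning x.

(* An assessment on a subfamily is a list of pairs [(S, prevision of C_S)]; it
   is coherent when it is the restriction of a coherent assessment on all the
   conjunctions, because the previsions of the smaller conjunctions are
   themselves values taken by the larger ones. *)
Definition coherent_on (a : seq ({set 'I_N} * R)) : Prop :=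
  exists x : {set 'I_N} -> R,
    coherent_conjunctions x /\ {in a, forall p, x p.1 = p.2}.

End Conjunction.

Definition convex_hull (R : realType) (V : lmodType R) (Q : seq V) : set V :=
  [set p : V | exists l : 'I_(size Q) -> R,
    [/\ forall h, 0 <= l h, \sum_h l h = 1 & p = \sum_h l h *: Q`_h]]%classic.

Definition point3 (R : realType) (a b c : R) : 'rV[R]_3 :=
  \row_(j < 3) [:: a; b; c]`_j.

(* Main.v *)
Require Import Defs.
From mathcomp Require Import all_boot all_order all_algebra.
From mathcomp Require Import boolp classical_sets reals numfun.
From mathcomp Require Import lra.

(** Why the theorem holds.

    Necessity rests on three inequalities that any coherent assessment of all
    the conjunctions satisfies, with the convention that the empty conjunction
    is sure and has prevision 1: nonnegativity ([coherent_ge0]), antitonicity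
    in the index set ([coherent_antitone]), and the Frechet lower bound
    x_S + x_T - 1 <= x_(S u T) ([coherent_frechet]).  Each is a linear
    inequality between previsions, and coherence transfers to the previsions
    any linear inequality that holds between the values of the conjunctions
    ([coherent_witness]).  In a world where not every conditioning event with
    index in T fails, the value of C_T is 0 or the prevision of the
    conjunction over a proper subset of T (the void indices), so the
    inequality between values is an instance of the same inequality for
    smaller index sets: all three follow by induction on the cardinal.  This
    works because the three families of inequalities are stable under passing
    to the void indices, which commutes with unions.

    For sufficiency, a point of the hull is a mixture of the four vertices,
    and each vertex describes a set A of conditional events that are true, all
    the others being false: everything (Q1), the first n (Q2), the last one
    (Q3), nothing (Q4).  Logical independence realises each such set by a world
    where all the H_i hold.  Letting x_S be the total weight of the sets A that
    contain S extends the point to an assessment of all the conjunctions, and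
    every gain has mean 0 over these worlds, so that its minimum and maximum
    lie on either side of 0 ([mixture_coherent]).

    The equivalence of the hull with the system of inequalities is the explicit
    decomposition with weights mu_(n+1), mu_n - mu_(n+1), x_(n+1) - mu_(n+1)
    and 1 - mu_n - x_(n+1) + mu_(n+1); it closes the cycle coherent ->
    inequalities -> hull -> coherent. *)

Set Implicit Arguments.
Unset Strict Implicit.
Unset Printing Implicit Defensive.

Import Order.TTheory GRing.Theory Num.Theory.
Local Open Scope ring_scope.

(** * Functions with finitely many values attain their minimum *)

Lemma ex_minimizer (R : realDomainType) (Omega : Type) (K : finType)
    (phi : Omega -> K) (D : set Omega) (f : Omega -> R) :
  (forall w w', phi w = phi w' -> f w = f w') -> (D !=set0)%classic ->
  exists2 w, D w & forall w', D w' -> f w <= f w'.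
Proof.
move=> f_phi [w0 Dw0].
have /boolp.choice[v vP] (k : K) : exists v,
    D v /\ forall w, D w -> phi w = k -> f v = f w.
  have [[w [Dw wk]]|nk] := pselect (exists w, D w /\ phi w = k).
    by exists w; split=> // w' _ w'k; apply: f_phi; rewrite wk.
  by exists w0; split=> // w Dw wk; case: nk; exists w.
have [k _ kmin] := arg_minP (fun k => f (v k)) (erefl : predT (phi w0)).
exists (v k) => [|w Dw]; first by have [] := vP k.
by have [_ /(_ w Dw erefl) <-] := vP (phi w); exact: kmin.
Qed.

(** * Conjunctions and their gains *)

Section Coherence.
Variables (R : realType) (Omega : Type) (N : nat) (E H : 'I_N -> set Omega).
Implicit Types (x : {set 'I_N} -> R) (S T : {set 'I_N}) (w : Omega).

(** The value 1 of a conjunction none of whose members is false or void is the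
    prevision of the empty conjunction; with this convention the value of any
    conjunction is 0 or the prevision of its void part. *)
Definition sure_at_empty x S : R := if S == finset.set0 then 1 else x S.

Definition has_false S w : bool := [exists i in S, ce_false E H i w].

Definition void_part S w : {set 'I_N} := [set i in S | ce_void H i w]%SET.

Lemma conjunctionE x S w :
  conjunction E H x S w =
  if has_false S w then 0 else sure_at_empty x (void_part S w).
Proof. by []. Qed.

Lemma has_falseU S T w :
  has_false (S :|: T)%SET w = has_false S w || has_false T w.
Proof.
apply/exists_inP/orP => [[i /setUP[iS|iT] fi]|[|] /exists_inP[i ij fi]].
- by left; apply/exists_inP; exists i.
- by right; apply/exists_inP; exists i.
- by exists i => //; rewrite finset.in_setU ij.
- by exists i => //; rewrite finset.in_setU ij orbT.
Qed.

Lemma void_partU S T w :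
  void_part (S :|: T)%SET w = (void_part S w :|: void_part T w)%SET.
Proof. by apply/setP => i; rewrite !finset.inE andb_orl. Qed.

Lemma void_part_lt T w : conditioning H T w -> (#|void_part T w| < #|T|)%N.
Proof.
move=> [i iT Hi]; apply: proper_card; apply/properP; split.
  by apply/fintype.subsetP => j; rewrite !finset.inE => /andP[].
by exists i => //; rewrite finset.inE /ce_void mem_set // andbF.
Qed.

(** When all the members of S are void, C_S takes its own prevision as value, so
    the indicator of the conditioning event can be dropped from the gain. *)
Lemma gain_term x S w : S != finset.set0 ->
  \1_(conditioning H S) w * (conjunction E H x S w - x S) =
  conjunction E H x S w - sure_at_empty x S.
Proof.
move=> /negPf S0; rewrite /sure_at_empty S0 indicE.
have [_|/negP nSw] := boolP (w \in _); first by rewrite mul1r.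
have nH i : i \in S -> w \notin H i.
  by move=> iS; apply/negP => /set_mem Hi; apply: nSw; apply/mem_set; exists i.
rewrite mul0r conjunctionE.
have -> : has_false S w = false.
  by apply/exists_inP => -[i /nH/negPf nHi]; rewrite /ce_false nHi.
have -> : void_part S w = S.
  apply/setP => i; rewrite finset.inE; case: (boolP (i \in S)) => //.
  by move=> /nH.
by rewrite /sure_at_empty S0 subrr.
Qed.

Lemma gainE x (J : {set {set 'I_N}}) (s : {set 'I_N} -> R) w :
  J \subset [set S : {set 'I_N} | S != finset.set0]%SET ->
  gain (conjunction E H x) (conditioning H) x s J w =
  \sum_(S in J) s S * (conjunction E H x S w - sure_at_empty x S).
Proof.
move=> /fintype.subsetP JF; apply: eq_bigr => S SJ; rewrite -mulrA gain_term //.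
by have := JF _ SJ; rewrite finset.inE.
Qed.

(** * Inequalities satisfied by coherent assessments *)

(** Coherence for the family of all the conjunctions over nonempty subsets of
    T: if a linear combination of the C_S is at least d in every world of the
    conditioning event of T, then so is the same combination of their
    previsions.  Stakes come as a list, so that the index sets may coincide and
    may be empty. *)
Lemma coherent_witness x T (r : seq (R * {set 'I_N})) :
  coherent_conjunctions E H x -> T != finset.set0 ->
  (forall p, p \in r -> p.2 \subset T) ->
  exists2 w, conditioning H T w &
    \sum_(p <- r) p.1 * (conjunction E H x p.2 w - sure_at_empty x p.2) <= 0.
Proof.
move=> coh T0 rT.
pose J := [set S : {set 'I_N} | (S != finset.set0) && (S \subset T)]%SET.
pose s S := \sum_(p <- r | p.2 == S) p.1.
have JF : J \subset [set S : {set 'I_N} | S != finset.set0]%SET.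
  by apply/fintype.subsetP => S; rewrite !finset.inE => /andP[].
have J0 : J != finset.set0.
  by apply/set0Pn; exists T; rewrite finset.inE T0 /=.
have [m [M [[[w [S SJ [i iS Hi]] Gw] _] _ m_le0 _]]] := coh J s JF J0.
exists w.
  exists i => //=; move: SJ iS; rewrite /= finset.inE => /andP[_].
  by move=> /fintype.subsetP; apply.
move: m_le0; rewrite -Gw gainE //; apply: le_trans.
rewrite le_eqVlt; apply/orP; left; apply/eqP.
(* Regroup the list by index set; the empty set contributes 0. *)
under [RHS]eq_bigr => U _ do rewrite mulr_suml.
rewrite (exchange_big_dep predT) //= big_seq [RHS]big_seq.
apply: eq_bigr => p pr.
have [p0|p0] := eqVneq p.2 finset.set0.
  rewrite big1 => [|U /andP[]]; last first.
    by rewrite finset.inE => /andP[U0 _] /eqP pU; rewrite -pU p0 eqxx in U0.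
  rewrite p0 conjunctionE.
  have -> : has_false finset.set0 w = false.
    by apply/exists_inP => -[j]; rewrite finset.inE.
  have -> : void_part finset.set0 w = finset.set0.
    by apply/setP => j; rewrite !finset.inE.
  by rewrite subrr mulr0.
rewrite (big_pred1 p.2) // => U /=.
by rewrite finset.inE [RHS]eq_sym; case: (p.2 =P U) => [<-|_];
  rewrite ?andbF // p0 rT.
Qed.

Lemma coherent_ge0 x T : coherent_conjunctions E H x -> 0 <= sure_at_empty x T.
Proof.
move=> coh; have [k] := ubnP #|T|; elim: k T => // k IH T Tk.
have [->|T0] := eqVneq T finset.set0.
  by rewrite /sure_at_empty eqxx ler01.
have [|w /void_part_lt Vlt] := coherent_witness (r := [:: (1, T)]) coh T0.
  by move=> p; rewrite inE => /eqP ->.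
rewrite big_seq1 mul1r subr_le0; apply: le_trans.
rewrite conjunctionE; case: ifP => // _; apply: IH; exact: leq_trans Vlt Tk.
Qed.

(** Where some member of T is false, C_T is 0 and C_S is nonnegative by
    [coherent_ge0]; elsewhere the comparison of C_T with C_S is that of
    their void parts, and the void part of T is smaller than T. *)
Lemma coherent_antitone x S T : coherent_conjunctions E H x ->
  S \subset T -> sure_at_empty x T <= sure_at_empty x S.
Proof.
move=> coh; have [k] := ubnP #|T|; elim: k S T => // k IH S T Tk ST.
have [T0|T0] := eqVneq T finset.set0.
  by move: ST; rewrite T0 finset.subset0 => /eqP ->.
have [|w /void_part_lt Vlt] :=
    coherent_witness (r := [:: (1, S); (-1, T)]) coh T0.
  by move=> p; rewrite !inE => /orP[] /eqP ->.
rewrite big_cons big_seq1 /= mul1r mulN1r subr_le0 => le_ST.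
have {le_ST} : conjunction E H x T w <= conjunction E H x S w ->
    sure_at_empty x T <= sure_at_empty x S by lra.
apply.
rewrite -(finset.setUidPr ST) !conjunctionE has_falseU.
case: (has_false S w) => //=; case: (has_false T w) => /=.
  exact: coherent_ge0.
apply: IH; rewrite (finset.setUidPr ST) //; first exact: leq_trans Vlt Tk.
by rewrite -(finset.setUidPr ST) void_partU finset.subsetUl.
Qed.

(** Antitonicity, against the empty conjunction. *)
Lemma coherent_le1 x T : coherent_conjunctions E H x -> sure_at_empty x T <= 1.
Proof.
move=> coh; have := coherent_antitone coh (finset.sub0set T).
by rewrite {2}/sure_at_empty eqxx.
Qed.

Lemma conjunction_le1 x T w :
  coherent_conjunctions E H x -> conjunction E H x T w <= 1.
Proof.
by move=> coh; rewrite conjunctionE; case: ifP => // _; exact: coherent_le1.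
Qed.

(** Where some conjunct of S or T is false, the bound on the values says that
    the other conjunction is at most 1; elsewhere it is the bound for the void
    parts of S and T, whose union is the void part of the union. *)
Lemma coherent_frechet x S T : coherent_conjunctions E H x ->
  sure_at_empty x S + sure_at_empty x T - 1 <= sure_at_empty x (S :|: T)%SET.
Proof.
move=> coh; have [k] := ubnP #|(S :|: T)%SET|; elim: k S T => // k IH S T Tk.
have [|T0] := eqVneq (S :|: T)%SET finset.set0.
  move=> /eqP; rewrite finset.setU_eq0 => /andP[/eqP-> /eqP->].
  by rewrite finset.setU0 /sure_at_empty eqxx addrK.
have [|w /void_part_lt Vlt] :=
    coherent_witness (r := [:: (1, S :|: T)%SET; (-1, S); (-1, T)]) coh T0.
  move=> p; rewrite !inE => /or3P[] /eqP -> //=.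
  - exact: finset.subsetUl.
  - exact: finset.subsetUr.
rewrite !big_cons big_nil /= !mul1r !mulN1r addr0 => le_ST.
have {le_ST} : conjunction E H x S w + conjunction E H x T w - 1 <=
      conjunction E H x (S :|: T)%SET w ->
    sure_at_empty x S + sure_at_empty x T - 1 <= sure_at_empty x (S :|: T)%SET.
  by lra.
apply.
have [S1 T1] := (conjunction_le1 S w coh, conjunction_le1 T w coh).
move: S1 T1; rewrite !conjunctionE has_falseU.
case: (has_false S w) => /=; first by lra.
case: (has_false T w) => /= S1 _; first by lra.
by rewrite void_partU; apply: IH; rewrite -void_partU; exact: leq_trans Vlt Tk.
Qed.

(** * Assessments that are mixtures of truth assignments *)

Lemma gain_extrema x (J : {set {set 'I_N}}) (s : {set 'I_N} -> R)
    (D : set Omega) :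
  (D !=set0)%classic ->
  let G := gain (conjunction E H x) (conditioning H) x s J in
  exists m M, is_min (G @` D)%classic m /\ is_max (G @` D)%classic M.
Proof.
move=> D0 G.
(* The gain depends on a world only through the constituent it lies in. *)
pose phi w := [ffun i => (w \in E i, w \in H i)].
have Gphi w w' : phi w = phi w' -> G w = G w'.
  move=> /ffunP ww.
  have EE i : (w \in E i) = (w' \in E i) by have := ww i; rewrite !ffunE => -[].
  have HH i : (w \in H i) = (w' \in H i) by have := ww i; rewrite !ffunE => -[].
  apply: eq_bigr => S _; congr (_ * _ * (_ - _)).
    rewrite !indicE; congr (_%:R); congr nat_of_bool.
    by apply/idP/idP => /set_mem[i iS /mem_set iH]; apply/mem_set;
      exists i => //; apply/set_mem; rewrite (HH, =^~ HH).
  rewrite !conjunctionE; congr (if _ then _ else sure_at_empty x _).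
    by apply: eq_existsb => i; rewrite /ce_false EE HH.
  by apply/setP => i; rewrite !finset.inE /ce_void HH.
have [w Dw wmin] := ex_minimizer Gphi D0.
have [|u Du umax] := @ex_minimizer _ _ _ phi D (fun w => - G w) _ D0.
  by move=> v v' /Gphi ->.
exists (G w), (G u); split; split; [by exists w| |by exists u|].
- by move=> _ [v Dv <-]; exact: wmin.
- by move=> _ [v Dv <-]; rewrite -lerN2; exact: umax.
Qed.

(** In a world where every H_i holds no conditional event is void, so all the
    conjunctions are two-valued there. *)
Lemma independent_world : logically_independent (all_events E H) ->
  forall A : {set 'I_N}, exists w,
    (forall i, H i w) /\ (forall i, (w \in E i) = (i \in A)).
Proof.
move=> indep A.
have [w wP] := indep (fun k => if k is inl i then i \in A else true).
exists w; split=> i; first exact: (wP (inr i)).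
have := wP (inl i) I => /=.
by case: (i \in A) => [/mem_set//|nE]; apply/negbTE/negP => /set_mem.
Qed.

(** The worlds in which exactly the conditional events of A_h are true, weighted
    by l_h, form a probability under which each C_S has mean x_S; hence every
    gain has mean 0, whatever the stakes and the subfamily. *)
Lemma mixture_coherent (I : finType) (l : I -> R) (A : I -> {set 'I_N}) :
  logically_independent (all_events E H) ->
  (forall h, 0 <= l h) -> \sum_h l h = 1 ->
  coherent_conjunctions E H (fun S => \sum_h l h * (S \subset A h)%:R).
Proof.
move=> indep l_ge0 l_sum J s JF J0; set x := fun S => _.
set D := (\bigcup_(j in _) _)%classic.
have /boolp.choice[w wP] (h : I) := independent_world indep (A h).
have Dall v : (forall i, H i v) -> D v.
  move=> Hv; have [S SJ] := set0Pn _ J0.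
  have := fintype.subsetP JF _ SJ; rewrite finset.inE => /set0Pn[i iS].
  by exists S => //; exists i.
have D0 : (D !=set0)%classic.
  have [v [Hv _]] := independent_world indep finset.set0.
  by exists v; exact: Dall.
have [m [M [mP MP]]] := gain_extrema x J s D0.
set G := gain _ _ _ _ _ in mP MP *.
have conjw h S : conjunction E H x S (w h) = (S \subset A h)%:R.
  have [Hw Ew] := wP h; rewrite conjunctionE.
  have -> : has_false S (w h) = ~~ (S \subset A h).
    apply/exists_inP/subsetPn => -[i iS].
      by rewrite /ce_false Ew => /andP[_]; exists i.
    by exists i => //; rewrite /ce_false Ew mem_set.
  have -> : void_part S (w h) = finset.set0.
    by apply/setP => i; rewrite !finset.inE /ce_void mem_set // andbF.
  by rewrite /sure_at_empty eqxx; case: (S \subset A h).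
have fair : \sum_h l h * G (w h) = 0.
  under eq_bigr => h _ do rewrite /G gainE // mulr_sumr.
  rewrite exchange_big big1 //= => S SJ.
  have := fintype.subsetP JF _ SJ.
  rewrite finset.inE /sure_at_empty => /negPf ->.
  under eq_bigr => h _ do rewrite mulrCA conjw mulrBr.
  by rewrite -mulr_sumr big_split /= sumrN -mulr_suml l_sum mul1r subrr mulr0.
exists m, M; split=> //.
- rewrite -fair -[m]mul1r -l_sum mulr_suml; apply: ler_sum => h _.
  apply: ler_wpM2l => //; apply: mP.2; exists (w h) => //.
  by apply: Dall; case: (wP h).
- rewrite -fair -[M]mul1r -l_sum mulr_suml; apply: ler_sum => h _.
  apply: ler_wpM2l => //; apply: MP.2; exists (w h) => //.
  by apply: Dall; case: (wP h).
Qed.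

End Coherence.

(** * The hull characterisation *)

Theorem theorem10 (R : realType) (Omega : Type) (n : nat) (n_ge1 : (1 <= n)%N)
    (E H : 'I_n.+1 -> set Omega)
    (indep : logically_independent (all_events E H))
    (mu_n x_n1 mu_n1 : R) :
  let Cn : {set 'I_n.+1} := [set i : 'I_n.+1 | (i < n)%N]%SET in
  let Clast : {set 'I_n.+1} := [set ord_max]%SET in
  let Cn1 : {set 'I_n.+1} := [set: 'I_n.+1]%SET in
  let M_coherent :=
    coherent_on E H [:: (Cn, mu_n); (Clast, x_n1); (Cn1, mu_n1)] in
  let hull := convex_hull [:: point3 1 1 1; point3 1 0 0;
                              point3 0 1 0; point3 0 0 0] in
  (M_coherent <-> hull (point3 mu_n x_n1 mu_n1)) /\
  (M_coherent <->
    [/\ 0 <= mu_n <= 1, 0 <= x_n1 <= 1,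
        Num.max (mu_n + x_n1 - 1) 0 <= mu_n1 &
        mu_n1 <= Num.min mu_n x_n1]).
Proof.
move=> Cn Clast Cn1 M_coherent hull.
pose frechet := [/\ 0 <= mu_n <= 1, 0 <= x_n1 <= 1,
  Num.max (mu_n + x_n1 - 1) 0 <= mu_n1 & mu_n1 <= Num.min mu_n x_n1].
have i0_Cn : ord0 \in Cn by rewrite finset.inE.
have last_Cn : ord_max \notin Cn by rewrite finset.inE ltnn.
have i0_Clast : ord0 \notin Clast.
  by rewrite finset.inE -val_eqE /= eq_sym -lt0n.
have last_Clast : ord_max \in Clast by rewrite finset.inE.
have necessary : M_coherent -> frechet.
  move=> [x [coh xP]].
  have [xCn xClast xCn1] : [/\ x Cn = mu_n, x Clast = x_n1 & x Cn1 = mu_n1].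
    by split; [apply: (xP (Cn, mu_n)) | apply: (xP (Clast, x_n1))
              | apply: (xP (Cn1, mu_n1))]; rewrite !inE eqxx ?orbT.
  have CnE : sure_at_empty x Cn = mu_n.
    rewrite -xCn /sure_at_empty.
    by case: eqP => // C0; rewrite C0 finset.inE in i0_Cn.
  have ClastE : sure_at_empty x Clast = x_n1.
    rewrite -xClast /sure_at_empty.
    by case: eqP => // C0; rewrite C0 finset.inE in last_Clast.
  have Cn1E : sure_at_empty x Cn1 = mu_n1.
    rewrite -xCn1 /sure_at_empty.
    by case: eqP => // /setP/(_ ord0); rewrite !finset.inE.
  have CnU : (Cn :|: Clast)%SET = Cn1.
    apply/setP => i; rewrite !finset.inE -val_eqE /= orbC -leq_eqVlt.
    by rewrite -ltnS ltn_ord.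
  have lower := coherent_frechet Cn Clast coh; rewrite CnU in lower.
  rewrite /frechet ge_max le_min -CnE -ClastE -Cn1E lower.
  by rewrite !(coherent_ge0 _ coh, coherent_le1 _ coh)
             !(coherent_antitone coh (finset.subsetT _)).
have in_hull : frechet -> hull (point3 mu_n x_n1 mu_n1).
  rewrite /frechet ge_max le_min => -[_ _ /andP[lo ge0] /andP[le_n le_last]].
  exists (fun h : 'I_4 => [:: mu_n1; mu_n - mu_n1; x_n1 - mu_n1;
                              1 - mu_n - x_n1 + mu_n1]`_h).
  split.
  - by case=> -[|[|[|[|//]]]] hlt /=; lra.
  - by rewrite !big_ord_recl big_ord0 /=; lra.
  - rewrite !big_ord_recl big_ord0 /=; apply/rowP => j; rewrite !mxE.
    by case: j => -[|[|[|//]]] jlt /=; lra.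
have sufficient : hull (point3 mu_n x_n1 mu_n1) -> M_coherent.
  move=> [l [l_ge0 l_sum /rowP p_l]].
  pose A (h : 'I_4) : {set 'I_n.+1} := nth finset.set0 [:: Cn1; Cn; Clast] h.
  (* The default value of [nth] gives the empty set for the vertex Q4. *)
  exists (fun S : {set 'I_n.+1} => \sum_h l h * (S \subset A h)%:R).
  split; first exact: mixture_coherent.
  have not_sub (i : 'I_n.+1) (S T : {set 'I_n.+1}) :
      i \in S -> i \notin T -> (S \subset T) = false.
    by move=> iS iT; apply/negbTE/subsetPn; exists i.
  have values := (p_l 0, p_l 1, p_l (inord 2)).
  move: values; rewrite !mxE !summxE !big_ord_recl !big_ord0 !mxE /=.
  rewrite ?inordK //=.
  move=> [[pn plast] pn1] p.
  have not0 (i : 'I_n.+1) : i \notin finset.set0 by rewrite finset.inE.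
  have inT (i : 'I_n.+1) : i \in Cn1 by rewrite finset.inE.
  rewrite !inE => /or3P[] /eqP -> /=;
    rewrite !big_ord_recl big_ord0 /A /= finset.subsetT.
  - rewrite fintype.subxx (not_sub _ _ _ i0_Cn i0_Clast).
    by rewrite (not_sub _ _ _ i0_Cn (not0 _)) pn !(mulr0, mulr1, addr0, add0r).
  - rewrite fintype.subxx (not_sub _ _ _ last_Clast last_Cn).
    by rewrite (not_sub _ _ _ last_Clast (not0 _)) plast
      !(mulr0, mulr1, addr0, add0r).
  - rewrite (not_sub _ _ _ (inT _) last_Cn) (not_sub _ _ _ (inT _) i0_Clast).
    by rewrite (not_sub _ _ _ (inT ord0) (not0 _)) pn1
      !(mulr0, mulr1, addr0, add0r).
by split; split; auto.
Qed.
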